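(* Let $X$ be a robust $X$-set parameter and let $\mathcal{B}_X$ be an inclusive component consistent $X$-irredundant blocking family for $X$. Let $G$ and $G'$ be graphs such that the XIr-TAR graphs of $G$ and $G'$ (with respect to $\mathcal{B}_X$) are isomorphic. If $\operatorname{XIR}(K_1)=1$ or $G$ and $G'$ have no isolated vertices, then $G$ and $G'$ have the same order and there is a relabeling of the vertices of $G'$ such that $G$ and $G'$ have exactly the same XIr-sets.
   Context: All graphs are finite, simple, undirected, with nonempty vertex set. A super $X$-set parameter $X$ is specified by a property of vertex subsets (the ''$X$-sets''), preserved under graph isomorphisms, such that every graph has at least one $X$-set and every superset of an $X$-set is an $X$-set. $X$ is component consistent if for every graph $G$ with connected components $G_1,\dots,G_k$, $S\subseteq V(G)$ is an $X$-set of $G$ iff $S\cap V(G_i)$ is an $X$-set of $G_i$ for each $i$. $X$ is robust if it is component consistent and, for every connected graph $G$ of order $n\ge 2$, every set of $n-1$ vertices is an $X$-set. A set $R\subseteq V(G)$ is an $X$-blocking set if $V(G)\setminus R$ is not an $X$-set. An $X$-blocking family $\mathcal{B}_X$ assigns to each graph $G$ a set $B_X(G)$ of $X$-blocking sets of $G$, compatible with isomorphism (if $G\cong H$ then after relabeling $B_X(G)=B_X(H)$). $\mathcal{B}_X$ is $X$-irredundant if for every $G$ and $S\subseteq V(G)$: $S$ is an $X$-set iff $S\cap R\ne\emptyset$ for all $R\in B_X(G)$. $\mathcal{B}_X$ is component consistent if for every graph $G$ with components $G_1,\dots,G_k$: (1) $R_i\in B_X(G_i)$ implies $R_i\in B_X(G)$;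 (2) $R\in B_X(G)$ implies that for each $i$, $R\cap V(G_i)\in B_X(G_i)$ or $R\cap V(G_i)=\emptyset$. A component consistent $\mathcal{B}_X$ is inclusive if for every connected graph $G$ of order at least two and every $v\in V(G)$ there is $R\in B_X(G)$ with $v\in R$. For $S\subseteq V(G)$, $u\in S$, a set $R\in B_X(G)$ is private for $u$ relative to $S$ if $S\cap R=\{u\}$; $S$ is an XIr-set if every element of $S$ has a private set. $\operatorname{XIR}(G)$ is the maximum cardinality of an XIr-set of $G$. The XIr-TAR graph of $G$ has as vertices the XIr-sets of $G$, two being adjacent iff one is obtained from the other by adding or removing exactly one vertex. *)

(* Defs.v *)
From mathcomp Require Import all_boot.

Set Implicit Arguments.
Unset Strict Implicit.
Unset Printing Implicit Defensive.

Record graph := Graph {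
  vertex :> finType;
  edge : rel vertex;
  edge_sym : symmetric edge;
  edge_irr : irreflexive edge;
  vertex_gt0 : 0 < #|vertex| }.

Arguments edge {g} x y : rename.

Definition is_iso (G H : graph) (f : G -> H) : Prop :=
  bijective f /\ forall x y, edge (f x) (f y) = edge x y.

Definition isomorphic (G H : graph) : Prop := exists f : G -> H, is_iso f.

Definition connected (G : graph) : Prop :=
  forall x y : G, connect edge x y.

Definition isolated (G : graph) (v : G) : Prop := forall u : G, ~~ edge v u.

Definition no_isolated (G : graph) : Prop := forall v : G, ~ isolated v.

Section InducedSubgraph.

Variables (G : graph) (A : {set G}) (v : G) (vA : v \in A).

Definition induced_edge : rel {x : G | x \in A} :=
  fun x y => edge (val x) (val y).

Fact induced_sym : symmetric induced_edge.
Proof. by move=> x y; apply: edge_sym. Qed.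

Fact induced_irr : irreflexive induced_edge.
Proof. by move=> x; apply: edge_irr. Qed.

Fact induced_gt0 : 0 < #|{: {x : G | x \in A}}|.
Proof. by apply/card_gt0P; exists (exist _ v vA). Qed.

Definition induced : graph := Graph induced_sym induced_irr induced_gt0.

End InducedSubgraph.

Definition component_set (G : graph) (v : G) : {set G} :=
  [set u | connect edge v u].

Fact component_self (G : graph) (v : G) : v \in component_set v.
Proof. by rewrite inE connect0. Qed.

(* The connected components of G are the graphs [component v] for v : G; the
   same component is obtained from each of its vertices. *)
Definition component (G : graph) (v : G) : graph := induced (component_self v).

Definition component_val (G : graph) (v : G) (x : component v) : G := val x.

(* The trace of S on V(G_i), as a set of vertices of the graph G_i. *)
Definition component_trace (G : graph) (v : G) (S : {set G}) :
  {set component v} := [set x | component_val x \in S].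

(* A subset of V(G_i), as a set of vertices of G. *)
Definition component_lift (G : graph) (v : G) (R : {set component v}) :
  {set G} := [set component_val x | x in R].

Fact K1_sym : symmetric (fun _ _ : unit => false). Proof. by []. Qed.
Fact K1_irr : irreflexive (fun _ : unit => fun _ : unit => false).
Proof. by []. Qed.
Fact K1_gt0 : 0 < #|{: unit}|. Proof. by rewrite card_unit. Qed.

Definition K1 : graph := Graph K1_sym K1_irr K1_gt0.

(* Used both for an assignment of the X-sets and for a blocking family. *)
Definition set_family := forall G : graph, {set {set G}}.

Definition iso_invariant (F : set_family) : Prop :=
  forall (G H : graph) (f : G -> H), is_iso f ->
  forall S : {set G}, (f @: S \in F H) = (S \in F G).

Definition super_parameter (X : set_family) : Prop :=
  [/\ iso_invariant X,
      forall G : graph, exists S : {set G}, S \in X G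
    & forall (G : graph) (S T : {set G}),
        S \subset T -> S \in X G -> T \in X G].

Definition parameter_component_consistent (X : set_family) : Prop :=
  forall (G : graph) (S : {set G}),
    S \in X G <-> forall v : G, component_trace v S \in X (component v).

Definition robust (X : set_family) : Prop :=
  parameter_component_consistent X /\
  forall G : graph, connected G -> 2 <= #|G| ->
  forall S : {set G}, #|S| = #|G|.-1 -> S \in X G.

Definition blocking_set (X : set_family) (G : graph) (R : {set G}) : Prop :=
  ~: R \notin X G.

Definition blocking_family (X B : set_family) : Prop :=
  (forall (G : graph) (R : {set G}), R \in B G -> blocking_set X R) /\
  iso_invariant B.

Definition irredundant (X B : set_family) : Prop :=
  forall (G : graph) (S : {set G}),
    S \in X G <-> forall R : {set G}, R \in B G -> S :&: R != set0.

Definition family_component_consistent (B : set_family) : Prop :=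
  forall G : graph,
    (forall (v : G) (R : {set component v}),
       R \in B (component v) -> component_lift R \in B G) /\
    (forall R : {set G}, R \in B G ->
     forall v : G, component_trace v R \in B (component v) \/
                   component_trace v R = set0).

Definition inclusive (B : set_family) : Prop :=
  family_component_consistent B /\
  forall G : graph, connected G -> 2 <= #|G| ->
  forall v : G, exists2 R : {set G}, R \in B G & v \in R.

Definition private (B : set_family) (G : graph) (S : {set G}) (u : G)
  (R : {set G}) : bool := (R \in B G) && (S :&: R == [set u]).

Definition XIr_set (B : set_family) (G : graph) (S : {set G}) : bool :=
  [forall u in S, exists R : {set G}, private B S u R].

Definition XIR (B : set_family) (G : graph) : nat :=
  \max_(S : {set G} | XIr_set B S) #|S|.

Section TAR.

Variables (B : set_family) (G : graph).

Definition TAR_edge : rel {S : {set G} | XIr_set B S} :=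
  fun S T => [exists u : G,
    ((u \notin val S) && (val T == u |: val S)) ||
    ((u \in val S) && (val T == val S :\ u))].

Fact TAR_sym : symmetric TAR_edge.
Proof.
suff sub S T : TAR_edge S T -> TAR_edge T S by move=> S T; apply/idP/idP; apply: sub.
case/existsP=> u /orP[] /andP[uS /eqP defT]; apply/existsP; exists u.
  by rewrite defT setU11 setU1K ?eqxx ?orbT.
by rewrite defT setD11 setD1K ?eqxx.
Qed.

Fact TAR_irr : irreflexive TAR_edge.
Proof.
move=> S; apply/existsP=> -[u /orP[] /andP[uS /eqP eqS]].
  by case/negP: uS; rewrite eqS setU11.
by move: uS; rewrite eqS setD11.
Qed.

Fact TAR_gt0 : 0 < #|{: {S : {set G} | XIr_set B S}}|.
Proof.
have S0 : XIr_set B (set0 : {set G}) by apply/forall_inP=> u; rewrite inE.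
by apply/card_gt0P; exists (exist _ set0 S0).
Qed.

Definition TAR : graph := Graph TAR_sym TAR_irr TAR_gt0.

End TAR.

(* Main.v *)
Require Import Defs.
From mathcomp Require Import all_boot.

Set Implicit Arguments.
Unset Strict Implicit.
Unset Printing Implicit Defensive.

(* The XIr-sets of G form a subset-closed family, and the hypotheses on B make
   every singleton an XIr-set, so the TAR graph is a down-set of the hypercube
   on V(G) that uses every coordinate.  An isomorphism h between two such
   graphs comes from an isometry of hypercubes: since two vertices at distance
   2 of a hypercube have exactly two common neighbours, induction on #|S| gives
   h S = h set0 + t @: S (symmetric difference) with t injective.  Finally the
   translation by h set0 can be dropped, because two subset-closed families
   that are translates of each other are equal. *)

(** * Symmetric differences as moves in the hypercube *)

Definition symdiff (T : finType) (A C : {set T}) : {set T} :=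
  [set x | (x \in A) (+) (x \in C)].

Section SymDiff.

Variable T : finType.
Implicit Types (A C D : {set T}) (x y : T).

Lemma symdiffA : associative (@symdiff T).
Proof. by move=> A C D; apply/setP=> x; rewrite !inE addbA. Qed.

Lemma symdiffC : commutative (@symdiff T).
Proof. by move=> A C; apply/setP=> x; rewrite !inE addbC. Qed.

Lemma symdiff0 A : symdiff A set0 = A.
Proof. by apply/setP=> x; rewrite !inE addbF. Qed.

Lemma symdiffK A : cancel (symdiff A) (symdiff A).
Proof. by move=> C; apply/setP=> x; rewrite !inE addKb. Qed.

Lemma symdiff_inj A : injective (symdiff A).
Proof. exact: can_inj (symdiffK A). Qed.

Lemma symdiff_setU1 A x : x \notin A -> symdiff A [set x] = x |: A.
Proof.
move=> /negbTE xA; apply/setP=> y; rewrite !inE.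
by have [->|_] := eqVneq y x; rewrite ?xA ?addbF.
Qed.

Lemma symdiff_setD1 A x : x \in A -> symdiff A [set x] = A :\ x.
Proof.
move=> xA; apply/setP=> y; rewrite !inE.
by have [->|_] := eqVneq y x; rewrite ?xA ?addbF.
Qed.

(** Cancelling [A] leaves {x} + {z} = {y} + {w}, where + is symmetric difference. As [x] and [y]
    differ, either [z = x], or [x] must be matched by [w], and then [z = y]. *)
Lemma symdiff1_common_neighbour A C x y z w :
    x != y -> C = symdiff (symdiff A [set x]) [set z] ->
    C = symdiff (symdiff A [set y]) [set w] ->
  C = A \/ C = symdiff (symdiff A [set x]) [set y].
Proof.
move=> xy ->; rewrite -!symdiffA => /symdiff_inj /setP eqC.
have [<-|xz] := eqVneq x z.
  by left; apply/setP=> u; rewrite !inE addbb addbF.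
right; have := eqC x; have := eqC z; rewrite !inE !eqxx (negbTE xz) (negbTE xy).
rewrite eq_sym (negbTE xz) /=; case: (eqVneq z y) => [-> //|_].
by case: (eqVneq z w) => [<-|//]; rewrite (negbTE xz).
Qed.

End SymDiff.

(** * Down-closed families and their hypercube embeddings *)

Definition down_closed (T : finType) (D : pred {set T}) : Prop :=
  forall A C : {set T}, A \subset C -> D C -> D A.

Lemma down_closed_translate (T : finType) (D E : pred {set T}) (F : {set T}) :
    down_closed D -> down_closed E ->
    (forall S, D S = E (symdiff F S)) -> D =1 E.
Proof.
have sub (P Q : pred {set T}) : down_closed P -> down_closed Q ->
    (forall S, P S = Q (symdiff F S)) -> subpred P Q.
  move=> downP downQ eqPQ S PS; apply: (downQ _ (F :|: S)); first exact: subsetUr.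
  have -> : F :|: S = symdiff F (S :\: F).
    by apply/setP=> x; rewrite !inE; case: (x \in F); case: (x \in S).
  by rewrite -eqPQ; apply: downP PS; apply: subsetDl.
move=> downD downE eqDE S; apply/idP/idP; first exact: sub.
by apply: (sub E D) => // A; rewrite eqDE symdiffK.
Qed.

Section HypercubeEmbedding.

Variables (V W : finType) (D : pred {set V}) (phi : {set V} -> {set W}).
Hypotheses (downD : down_closed D) (D1 : forall x, D [set x]) (D0 : D set0).
Hypothesis phi_inj : forall S T, D S -> D T -> phi S = phi T -> S = T.
Hypothesis phi_adj : forall S x, D S -> D (symdiff S [set x]) ->
  exists y, phi (symdiff S [set x]) = symdiff (phi S) [set y].

Lemma down_closed_embedding :
  exists2 t : V -> W, injective t &
    forall S, D S -> phi S = symdiff (phi set0) (t @: S).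
Proof.
(* [t x] is the coordinate that [phi] toggles along the edge from [set0] to [[set x]]; it exists for
   every [x] because all singletons lie in [D]. *)
have /fin_all_exists[t phi1] x :
    exists y, phi [set x] = symdiff (phi set0) [set y].
  have := @phi_adj set0 x D0; rewrite symdiffC symdiff0; exact.
have t_inj : injective t.
  by move=> x y eqt; apply/set1_inj/phi_inj; rewrite ?phi1 ?eqt.
exists t => // S; have [n] := ubnP #|S|; elim: n S => // n IHn S leSn DS.
have [->|[x xS]] := set_0Vmem S; first by rewrite imset0 symdiff0.
have [Sx0|[y ySx]] := set_0Vmem (S :\ x).
  by rewrite -(setD1K xS) Sx0 setU0 imset_set1 phi1.
set P := S :\ x :\ y.
have yS : y \in S by move: ySx; rewrite !inE => /andP[].
have yx : y != x by move: ySx; rewrite !inE => /andP[].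
have DD1 z : D (S :\ z) by apply: downD DS; apply: subsetDl.
have DP : D P by apply: downD (DD1 x); apply: subsetDl.
have SxE : S :\ x = y |: P by rewrite setD1K.
have SyE : S :\ y = x |: P.
  apply/setP=> u; rewrite !inE.
  by have [->|_] := eqVneq u x; rewrite ?xS // eq_sym yx.
have xP : x \notin P by rewrite !inE eqxx andbF.
have yP : y \notin P by rewrite !inE eqxx.
have cardD1 z : z \in S -> #|S :\ z| < n.
  by move=> zS; move: leSn; rewrite (cardsD1 z S) zS add1n ltnS.
(* The induction formulas at [P] and [z |: P] differ exactly by [t z], as injectivity keeps [t z]
   outside [t @: P]. *)
have IHU z : z \notin P -> #|z |: P| < n -> D (z |: P) ->
    phi (z |: P) = symdiff (phi P) [set t z].
  move=> zP ltn DzP; rewrite IHn // [phi P]IHn //; last first.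
    by apply: leq_ltn_trans ltn; rewrite subset_leq_card ?subsetUr.
  rewrite -symdiffA symdiff_setU1 ?imsetU1 //.
  by apply/imsetP=> -[w wP /t_inj eqw]; rewrite eqw wP in zP.
have phix : phi (S :\ y) = symdiff (phi P) [set t x].
  by rewrite SyE IHU // -SyE // cardD1.
have phiy : phi (S :\ x) = symdiff (phi P) [set t y].
  by rewrite SxE IHU // -SxE // cardD1.
have step z : z \in S -> exists w, phi S = symdiff (phi (S :\ z)) [set w].
  move=> zS; have SE : S = symdiff (S :\ z) [set z].
    by rewrite symdiff_setU1 ?setD11 // setD1K.
  have /(_ (DD1 z)) := @phi_adj (S :\ z) z; rewrite -SE; exact.
(* [phi S] is a common neighbour of the distinct sets phi P + {t x} and phi P + {t y}. Of the two
   candidates, [phi P] is excluded by injectivity of [phi] on [D]. *)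
have [w] := step x xS; have [z] := step y yS; rewrite phix phiy => eqz eqw.
have txy : t x != t y by rewrite (inj_eq t_inj) eq_sym.
case: (symdiff1_common_neighbour txy eqz eqw) => [|->].
  by move/phi_inj=> /(_ DS DP) eqSP; rewrite -eqSP xS in xP.
rewrite -phix IHn ?cardD1 // -symdiffA symdiff_setU1.
  by rewrite -imsetU1 setD1K.
by apply/imsetP=> -[u uS /t_inj eqy]; rewrite -eqy setD11 in uS.
Qed.

End HypercubeEmbedding.

(** * Recovering a down-closed family from its graph *)

Definition toggle_adjacent (V : finType) (S T : {set V}) : Prop :=
  exists x, T = symdiff S [set x].

Section DownClosedGraphs.

Variables (V W : finType) (D : pred {set V}) (E : pred {set W}).
Hypotheses (downD : down_closed D) (D1 : forall x, D [set x]) (D0 : D set0).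
Variable h : {S | D S} -> {S | E S}.
Hypothesis h_inj : injective h.
Hypothesis h_adj : forall s t, toggle_adjacent (val s) (val t) ->
  toggle_adjacent (val (h s)) (val (h t)).

Lemma down_closed_morphism : exists t : V -> W, injective t /\
  exists F, forall s, val (h s) = symdiff F (t @: val s).
Proof.
(* The value [set0] outside [D] is junk: [phi] is only evaluated on members of [D]. *)
pose phi S := oapp (fun s => val (h s)) set0 (insub S).
have phiE S (DS : D S) : phi S = val (h (Sub S DS)) by rewrite /phi insubT.
have phi_inj S T : D S -> D T -> phi S = phi T -> S = T.
  by move=> DS DT; rewrite !phiE => /val_inj/h_inj/(congr1 val).
have phi_adj S x : D S -> D (symdiff S [set x]) ->
    exists y, phi (symdiff S [set x]) = symdiff (phi S) [set y].
  by move=> DS DSx; rewrite !phiE; apply: h_adj; exists x.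
have [t t_inj tE] := down_closed_embedding downD D1 D0 phi_inj phi_adj.
by exists t; split=> //; exists (phi set0) => -[S DS]; rewrite -tE ?phiE.
Qed.

End DownClosedGraphs.

(** The coordinate maps of [h] and of its inverse [g] are injections in opposite directions, hence
    bijections. The formula for [g] makes [D] a translate of [E] transported along [f], and the
    translation is then dropped. *)
Lemma down_closed_reconstruction (V W : finType)
    (D : pred {set V}) (E : pred {set W}) (h : {S | D S} -> {S | E S}) :
    down_closed D -> down_closed E ->
    (forall x, D [set x]) -> (forall y, E [set y]) -> D set0 -> E set0 ->
    bijective h ->
    (forall s t, toggle_adjacent (val (h s)) (val (h t)) <->
                 toggle_adjacent (val s) (val t)) ->
  #|V| = #|W| /\ exists f : W -> V, bijective f /\
    forall S : {set W}, D (f @: S) = E S.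
Proof.
move=> downD downE D1 E1 D0 E0 [g hK gK] h_adj.
have [t [t_inj _]] : exists t : V -> W, injective t /\
    exists F, forall s, val (h s) = symdiff F (t @: val s).
  by apply: down_closed_morphism => // [|s u /h_adj //]; apply: can_inj hK.
have [f [f_inj [F gE]]] : exists f : W -> V, injective f /\
    exists F, forall s, val (g s) = symdiff F (f @: val s).
  apply: down_closed_morphism => // [|s u su]; first exact: can_inj gK.
  by apply/h_adj; rewrite !gK.
have eqVW : #|V| = #|W|.
  by apply/eqP; rewrite eqn_leq (leq_card t) ?(leq_card f).
split=> //; exists f; split; first by apply: inj_card_bij; rewrite ?eqVW.
have preimK (S : {set W}) : f @^-1: (f @: S) = S.
  by apply/setP=> y; rewrite inE mem_imset.
have imK (S : {set V}) : f @: (f @^-1: S) = S.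
  have [f' f'K fK] : bijective f by apply: inj_card_bij; rewrite ?eqVW.
  by apply/setP=> x; rewrite -[x]fK mem_imset // inE.
suff DE : D =1 (fun S => E (f @^-1: S)) by move=> S; rewrite DE preimK.
apply: (@down_closed_translate _ _ _ F) => //.
  by move=> A C /(preimsetS f) sAC; apply: downE.
move=> S; apply/idP/idP => [DS | EFS].
  have := gE (h (Sub S DS)); rewrite hK /= => ->.
  by rewrite symdiffK preimK; apply: valP.
by have := valP (g (Sub _ EFS)); rewrite gE /= imK symdiffK.
Qed.

(** * XIr-sets and the TAR graph *)

Section XIrSets.

Variables (B : set_family) (G : graph).

(** A set private for [u] relative to [C] stays private relative to any subset of [C] that contains
    [u]. *)
Lemma XIr_down_closed : down_closed (@XIr_set B G).
Proof.
move=> A C sAC /forall_inP XC; apply/forall_inP=> u uA.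
have /existsP[R /andP[BR /eqP CR]] := XC u (subsetP sAC u uA).
apply/existsP; exists R; rewrite /private BR; apply/eqP/setP=> x.
have := congr1 (fun S : {set G} => x \in S) CR; rewrite !inE.
have [->|_] := eqVneq x u; first by rewrite uA (subsetP sAC) //= => ->.
by have [/(subsetP sAC)->|] := boolP (x \in A).
Qed.

Lemma XIr_set0 : XIr_set B (set0 : {set G}).
Proof. by apply/forall_inP=> u; rewrite inE. Qed.

Lemma XIr_set1 (R : {set G}) v : R \in B G -> v \in R -> XIr_set B [set v].
Proof.
move=> BR vR; apply/forall_inP=> u /set1P->; apply/existsP; exists R.
by rewrite /private BR; apply/eqP/setIidPl; rewrite sub1set.
Qed.

Lemma TAR_edgeP (s t : TAR B G) :
  edge s t <-> toggle_adjacent (val s) (val t).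
Proof.
split=> [/existsP[u /orP[] /andP[uS /eqP->]] | [u eqt]].
- by exists u; rewrite symdiff_setU1.
- by exists u; rewrite symdiff_setD1.
apply/existsP; exists u; rewrite eqt.
have [uS|uS] := boolP (u \in val s).
  by rewrite symdiff_setD1 ?eqxx.
by rewrite symdiff_setU1 ?eqxx.
Qed.

End XIrSets.

(** * Singletons are XIr-sets *)

Lemma component_connected (G : graph) (v : G) : connected (component v).
Proof.
pose r : component v := Sub v (component_self v).
have from_r (x : component v) : connect edge r x.
  case: x => x xC; have := xC; rewrite inE => /connectP[p].
  (* Every prefix of a path from [v] ends in the component, so the path lifts edge by edge to the
     induced subgraph. *)
  elim/last_ind: p x xC => [|p y IHp] x xC /=.
    move=> _ eqx; have -> : exist _ x xC = r by apply: val_inj.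
    exact: connect0.
  rewrite rcons_path last_rcons => /andP[vp py] eqx; subst y.
  have lC : last v p \in component_set v by rewrite inE; apply/connectP; exists p.
  exact: connect_trans (IHp _ lC vp erefl) (connect1 _).
move=> x y; apply: connect_trans (from_r y).
by rewrite (sym_connect_sym (@edge_sym _)).
Qed.

(** The full set is the only nonempty set of vertices of [K1]; were it not in [B K1], no vertex
    could have a private set and [XIR] would be 0. *)
Lemma XIR_K1_setT (B : set_family) : XIR B K1 = 1 -> [set: K1] \in B K1.
Proof.
move=> XIR1; have : 0 < XIR B K1 by rewrite XIR1.
apply: contraLR => nBT; rewrite -leqNgt; apply/bigmax_leqP=> S /forall_inP XS.
rewrite leqn0 cards_eq0; apply/set0Pn=> -[u uS].
have /existsP[R /andP[BR /eqP SR]] := XS u uS.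
case/negP: nBT; rewrite (_ : setT = R) //; apply/setP=> -[]; rewrite inE.
by have := set11 u; rewrite -SR inE => /andP[_]; case: u {uS SR}.
Qed.

Lemma XIr_singleton (B : set_family) (G : graph) (v : G) :
    iso_invariant B -> inclusive B ->
    XIR B K1 = 1 \/ no_isolated G ->
  XIr_set B [set v].
Proof.
move=> isoB [/(_ G)[liftB _] inclB] noK1.
pose r : component v := Sub v (component_self v).
(* Component consistency lifts a member of [B] from the component of [v] to [G], so only the
   component matters: inclusiveness settles order at least 2. *)
suff [R BR rR] : exists2 R, R \in B (component v) & r \in R.
  by apply: (XIr_set1 (liftB _ _ BR)); apply/imsetP; exists r.
have [gt1|le1] := ltnP 1 #|component v|.
  by apply: inclB => //; apply: component_connected.
have eqr (x : component v) : x = r by apply: fintype_le1P.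
case: noK1 => [/XIR_K1_setT BT|noisoG]; last first.
  case: (noisoG v) => u; apply/negP=> vu.
  have uC : u \in component_set v by rewrite inE connect1.
  have /(congr1 (@component_val G v)) equv := eqr (Sub u uC).
  by move: vu; rewrite [u]equv edge_irr.
(* A component with one vertex is a copy of [K1], and isomorphism invariance carries the full set
   over. *)
pose f (_ : K1) := r.
have iso_f : is_iso f.
  split=> [|x y]; last by rewrite edge_irr.
  by exists (fun _ => tt : K1) => [[]|x] //; rewrite [RHS]eqr.
exists (f @: setT); first by rewrite isoB.
by apply/imsetP; exists (tt : K1).
Qed.

Theorem theorem2p19 (X B : set_family)
  (superX : super_parameter X) (robustX : robust X)
  (blockB : blocking_family X B) (irrB : irredundant X B)
  (inclB : inclusive B)
  (G G' : graph)
  (isoTAR : isomorphic (TAR B G) (TAR B G'))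
  (noK1 : XIR B K1 = 1 \/ (no_isolated G /\ no_isolated G')) :
  #|G| = #|G'| /\
  exists f : G' -> G, bijective f /\
    forall S : {set G'}, XIr_set B (f @: S) = XIr_set B S.
Proof.
have [_ isoB] := blockB; have [h [h_bij h_edge]] := isoTAR.
have XIr1 (H : graph) : XIR B K1 = 1 \/ no_isolated H ->
    forall v : H, XIr_set B [set v].
  by move=> noK1H v; apply: XIr_singleton.
apply: (down_closed_reconstruction (h := h)) => //.
- exact: XIr_down_closed.
- exact: XIr_down_closed.
- by apply: XIr1; case: noK1 => [|[]]; [left | right].
- by apply: XIr1; case: noK1 => [|[]]; [left | right].
- exact: XIr_set0.
- exact: XIr_set0.
by move=> s t; split=> /TAR_edgeP st; apply/TAR_edgeP; rewrite h_edge in st *.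
Qed.
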